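(* Let $GF(q')$ be a finite field, where $q'=q^{2\beta}$ for some prime power $q$ and $\beta\in\mathbb{N}$. Let $e\ge3$ with $e\mid q+1$, and $\eta=\frac{(-q)^\beta-1}{e}$. Let $u,w\in\mathbb{N}$ with $wu\le e$ and, for $1\le a\le w$, let $I_a\subset\{0,1,\ldots,e-1\}$ with $|I_a|=u$ and $I_a\cap I_b=\emptyset$ for $a\neq b$. Let $D_a=\bigcup_{i\in I_a}C_i^e$ and $\mathcal{W}'=\{D_1,\ldots,D_w\}$. Then (i) $\mathcal{W}'$ is a $(q',w,u\frac{q'-1}{e},u^2\eta^2+(3u-e)\eta-1+(w-1)(u^2\eta^2+u\eta),w(u^2\eta^2+u\eta))$-disjoint partial difference family; (ii) when $w\ge2$, $\mathcal{W}'$ is a $(q',w,u\frac{q'-1}{e},w(w-1)u^2\eta^2+2(w-1)u\eta,w(w-1)u^2\eta^2)$-external partial difference family; (iii) if $\mathcal{W}'$ does not partition $GF(q')^*$, then $\mathcal{W}'$ is a disjoint difference family if and only if each $D_a$ is a difference set; (iv) if $w\ge2$ and $\mathcal{W}'$ does not partition $GF(q')^*$, then $\mathcal{W}'$ is not an external difference family.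
   Context: $G=(GF(q'),+)$, $G^*=GF(q')^*=G\setminus\{0\}$; $\alpha$ is a primitive element of $GF(q')$ and $C_i^e=\alpha^i\langle\alpha^e\rangle$ are the cyclotomic classes of order $e$. $\Delta(D)$ is the multiset $\{x-y:x,y\in D,x\neq y\}$, $\Delta(D_1,D_2)$ the multiset $\{x-y:x\in D_1,y\in D_2\}$, $\lambda A$ is $\lambda$ copies of each element of $A$. A subset $D$ is a difference set if $\Delta(D)=\lambda G^*$ for some $\lambda$. A family $\{D_1,\dots,D_m\}$ of disjoint $k$-subsets of $G^*$ with union $S$ is a $(q',m,k,\lambda,\mu)$-disjoint partial difference family if $\bigcup_i\Delta(D_i)=\lambda S+\mu(G^*\setminus S)$, a $(q',m,k,\lambda,\mu)$-external partial difference family if $\bigcup_{i\neq j}\Delta(D_i,D_j)=\lambda S+\mu(G^*\setminus S)$; it is a disjoint difference family if $\bigcup_i\Delta(D_i)=\lambda G^*$ for some $\lambda$, and an external difference family if $\bigcup_{i\neq j}\Delta(D_i,D_j)=\lambda G^*$ for some $\lambda$. *)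

(* Defs.v *)
From mathcomp Require Export all_boot all_order all_algebra all_fingroup.
From mathcomp Require Export all_solvable all_field.
From mathcomp Require Export finmap multiset.

Set Implicit Arguments.
Unset Strict Implicit.
Unset Printing Implicit Defensive.

Import GRing.Theory.
Local Open Scope ring_scope.
Local Open Scope mset_scope.

Definition prime_power (q : nat) : Prop :=
  exists p n : nat, [/\ prime p, (0 < n)%N & q = (p ^ n)%N].

Section DifferenceFamilies.

Variable G : finZmodType.
Implicit Types (D S : {set G}) (m k v : nat) (lam mu : int).

Definition nonzero : {set G} := [set~ 0].

(* The unions of multisets of differences add multiplicities, so they are     *)
(* big sums for msetD; msetU would take the maximum of the multiplicities.    *)
Definition Delta D : {mset G} :=
  \big[@msetD G/mset0]_(x in D) \big[@msetD G/mset0]_(y in D | x != y)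
    [mset x - y].

Definition Delta2 (D1 D2 : {set G}) : {mset G} :=
  \big[@msetD G/mset0]_(x in D1) \big[@msetD G/mset0]_(y in D2) [mset x - y].

Definition copies (n : nat) (A : {set G}) : {mset G} :=
  \big[@msetD G/mset0]_(x in A) msetn n x.

Definition difference_set D : Prop :=
  exists l : nat, Delta D = copies l nonzero.

Definition disjoint_ksubsets m k (D : 'I_m -> {set G}) : Prop :=
  [/\ forall i, D i \subset nonzero,
      forall i, #|D i| = k
    & forall i j, i != j -> [disjoint D i & D j]].

Definition family_union m (D : 'I_m -> {set G}) : {set G} := \bigcup_i D i.

Definition internal_differences m (D : 'I_m -> {set G}) : {mset G} :=
  \big[@msetD G/mset0]_i Delta (D i).

Definition external_differences m (D : 'I_m -> {set G}) : {mset G} :=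
  \big[@msetD G/mset0]_i \big[@msetD G/mset0]_(j | i != j) Delta2 (D i) (D j).

(* lam and mu are integers because they will be given by expressions in an    *)
(* integer that can be negative; being numbers of copies, they are required   *)
(* to be natural numbers.                                                     *)
Definition two_level (M : {mset G}) S lam mu : Prop :=
  exists l n : nat,
    [/\ lam = l%:Z, mu = n%:Z
      & M = copies l S `+` copies n (nonzero :\: S)].

Definition is_DPDF v m k lam mu (D : 'I_m -> {set G}) : Prop :=
  [/\ #|G| = v, disjoint_ksubsets k D
    & two_level (internal_differences D) (family_union D) lam mu].

Definition is_EPDF v m k lam mu (D : 'I_m -> {set G}) : Prop :=
  [/\ #|G| = v, disjoint_ksubsets k D
    & two_level (external_differences D) (family_union D) lam mu].

Definition is_DDF m (D : 'I_m -> {set G}) : Prop :=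
  (exists k, disjoint_ksubsets k D) /\
  exists l : nat, internal_differences D = copies l nonzero.

Definition is_EDF m (D : 'I_m -> {set G}) : Prop :=
  (exists k, disjoint_ksubsets k D) /\
  exists l : nat, external_differences D = copies l nonzero.

End DifferenceFamilies.

Definition primitive_element (F : finFieldType) (alpha : {unit F}) : Prop :=
  generator [set: {unit F}] alpha.

Definition cyclotomic_class (F : finFieldType) (alpha : {unit F}) (e i : nat) :
    {set F} :=
  [set FinRing.uval x | x in (alpha ^+ i *: <[alpha ^+ e]>)%g].

(* For e dividing q + 1 the division is exact, since - q = 1 modulo e.        *)
Definition uniform_eta (q beta e : nat) : int :=
  (((- q%:Z) ^+ beta - 1) %/ e%:Z)%Z.

Arguments is_DPDF {G} v m k lam mu D.
Arguments is_EPDF {G} v m k lam mu D.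
Arguments is_DDF {G} m D.
Arguments is_EDF {G} m D.

(* Main.v *)
Require Import Defs.
From mathcomp Require Import all_character.
From mathcomp Require Import ring zify.

(* Let H be the group of nonzero (q+1)-th powers of F and psi a nontrivial additive
   character with psi (x^q) = psi x.  The sums S(a) = \sum_z psi (a z^(q+1)) come
   from Hermitian forms: S(a)^2 = q' for a outside one coset s H, and the congruence
   S(a) = 1 modulo q + 1 then forces S(a) = eps := (-q)^beta (signed_pow below); as
   S(a) sums to 0 over a <> 0, it equals -q eps on s H.  Averaging over H, the transform at a <> 0 of any
   H-stable set D is k - eps [s/a in D], where |D| = k (eps + 1).  Fourier inversion
   gives the number of solutions of x - y = c in D x E for all H-stable D and E.
   A union of u cyclotomic classes of order e is H-stable since e divides q + 1, and
   its k is u eta since e eta = eps - 1; the theorem follows by adding up these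
   numbers over the family. *)

Set Implicit Arguments.
Unset Strict Implicit.
Unset Printing Implicit Defensive.

Import Order.TTheory GRing.Theory Num.Theory.
Local Open Scope mset_scope.
Local Open Scope ring_scope.

(** * The additive [q]-th power map and a character invariant under it *)

Section AdditivePower.

Variables (F : finFieldType) (q : nat).
Hypothesis q_gt0 : (0 < q)%N.
Hypothesis frobD : forall x y : F, (x + y) ^+ q = x ^+ q + y ^+ q.

Lemma additive_powN (x : F) : (- x) ^+ q = - x ^+ q.
Proof.
by apply/eqP; rewrite -addr_eq0 -frobD addNr expr0n eqn0Ngt q_gt0.
Qed.

Lemma additive_pow_inj : injective (fun x : F => x ^+ q).
Proof.
move=> x y /= exy; apply/eqP; rewrite -subr_eq0.
have := frobD x (- y); rewrite additive_powN exy subrr => /eqP.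
by rewrite expf_eq0 => /andP[].
Qed.

(** Such characters are those trivial on [K], the image of the additive map taking [x] to
    [x ^+ q - x]. This map sends both 0 and 1 to 0, so [K] is a proper subgroup; [K] is the
    intersection of the kernels of the irreducible characters that are trivial on it, hence one of
    these is nontrivial. *)
Lemma exists_frobenius_invariant_character :
  exists psi : F -> algC,
    [/\ forall x y, psi (x + y) = psi x * psi y, psi 0 = 1,
        forall x, psi x \in Aint, forall x, psi (x ^+ q) = psi x
      & exists x, psi x != 1].
Proof.
pose H : {set F} := [set x ^+ q - x | x in [set: F]].
have gH : group_set H.
  apply/group_setP; split.
    by apply/imsetP; exists 0; rewrite ?inE // expr0n eqn0Ngt q_gt0 subr0.
  move=> _ _ /imsetP[x _ ->] /imsetP[y _ ->]; apply/imsetP; exists (x + y) => //.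
  by rewrite frobD FinRing.zmodMgE; ring.
pose K := Group gH.
have abF : abelian [set: F].
  by apply/centsP => x _ y _; rewrite /commute !FinRing.zmodMgE addrC.
have nK : (K <| [set: F])%g by rewrite -sub_abelian_normal ?subsetT.
have KnT : K != [set: F] :> {set F}.
  apply/negP => /eqP HT.
  have /imset_injP inj : #|[set x ^+ q - x | x in [set: F]]| == #|[set: F]|.
    by rewrite -[X in _ == #|pred_of_set X|]HT.
  have := inj 0 1; rewrite !inE expr0n eqn0Ngt q_gt0 expr1n !subrr.
  by move=> /(_ isT isT erefl)/esym/eqP; rewrite oner_eq0.
have [i /andP[sKi kiT]] : exists i : Iirr [set: F],
    (K \subset cfker 'chi_i) && ~~ ([set: F] \subset cfker 'chi_i).
  apply/existsP; apply: contraR KnT => /existsPn noi.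
  rewrite eqEsubset subsetT -{1}(cap_cfker_normal nK).
  by apply/bigcapsP => i sKi; have := noi i; rewrite sKi negbK.
have chiL : 'chi_i \is a linear_char by apply/char_abelianP.
exists 'chi_i; split=> [x y||x|x|].
- by rewrite -lin_charM ?inE.
- exact: lin_char1.
- exact: Aint_irr.
- rewrite -[in RHS](@cfkerMl _ _ _ (x ^+ q - x)) ?FinRing.zmodMgE ?subrK //.
  by apply: (subsetP sKi); apply: imset_f; rewrite inE.
- have [x _ /= xi] := subsetPn kiT; exists x; apply: contraNneq xi => xi1.
  by rewrite cfkerEirr inE xi1 lin_char1.
Qed.

End AdditivePower.

(** * Powers in the cyclic multiplicative group *)

Section PowerSubgroup.

Variables (F : finFieldType) (alpha : {unit F}).
Hypothesis alpha_prim : primitive_element alpha.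

Lemma order_primitive : #[alpha]%g = #|F|.-1.
Proof. by rewrite orderE -(eqP alpha_prim) card_finField_unit. Qed.

Lemma primitive_exp (x : F) : x != 0 -> exists j, x = val (alpha ^+ j)%g.
Proof.
move=> x_neq0; have xU : x \is a GRing.unit by rewrite unitfE.
have : FinRing.unit F xU \in <[alpha]>%g.
  by rewrite -(eqP alpha_prim) inE.
by case/cycleP => j ej; exists j; rewrite -ej.
Qed.

Lemma val_unit_eq1 (x : {unit F}) : (val x == 1) = (x == 1%g).
Proof. by rewrite -val_eqE. Qed.

(** For [x = alpha ^+ j], the order [d * m] of [alpha] divides [j * m], so [d] divides [j]. *)
Lemma exp_eq1_pow (d m : nat) (x : F) :
  (#|F|.-1 = d * m)%N -> (0 < m)%N -> x != 0 -> x ^+ m = 1 ->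
  exists2 z : F, z != 0 & x = z ^+ d.
Proof.
move=> cF m_gt0 x_neq0 xm; have [j ej] := primitive_exp x_neq0.
have : (alpha ^+ j ^+ m == 1)%g by rewrite -val_unit_eq1 FinRing.val_unitX -ej xm.
rewrite -expgM -order_dvdn order_primitive cF dvdn_pmul2r // => /dvdnP[k jE].
exists (val (alpha ^+ k)%g); first by rewrite -unitfE (valP (alpha ^+ k)%g).
by rewrite ej jE expgM !FinRing.val_unitX.
Qed.

Definition nonzero_powers (d : nat) : {set F} := [set x ^+ d | x in [set~ 0]].

Lemma nonzero_powersP (d : nat) (x : F) :
  reflect (exists2 z : F, z != 0 & x = z ^+ d) (x \in nonzero_powers d).
Proof.
by apply: (iffP imsetP) => -[z z0 ->]; exists z => //; move: z0; rewrite !inE.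
Qed.

Lemma nonzero_powers_cycle (d : nat) :
  nonzero_powers d = [set val x | x in <[alpha ^+ d]>%g].
Proof.
apply/setP => x; apply/nonzero_powersP/imsetP => [[z z0 ->]|[_ /cycleP[k ->] ->]].
  have [j ->] := primitive_exp z0; exists (alpha ^+ d ^+ j)%g.
    exact: mem_cycle.
  by rewrite -expgM mulnC expgM !FinRing.val_unitX.
exists (val (alpha ^+ k)%g); first by rewrite -unitfE (valP (alpha ^+ k)%g).
by rewrite -expgM mulnC expgM !FinRing.val_unitX.
Qed.

Lemma card_nonzero_powers (d : nat) :
  (d %| #|F|.-1)%N -> #|nonzero_powers d| = (#|F|.-1 %/ d)%N.
Proof.
move=> dF; rewrite nonzero_powers_cycle card_imset; last exact: val_inj.
by rewrite -orderE orderXdiv ?order_primitive.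
Qed.

End PowerSubgroup.

Lemma card_nonzero (R : finNzRingType) : #|[pred x : R | x != 0]| = #|R|.-1.
Proof. by rewrite (cardD1 0 R) inE /=; apply: eq_card => x; rewrite !inE andbT. Qed.

(** * Character sums over (q+1)-th powers *)

Section SemiprimitiveSums.

Variables (F : finFieldType) (alpha : {unit F}) (q beta : nat).
Hypothesis alpha_prim : primitive_element alpha.
Hypothesis q_gt1 : (1 < q)%N.
Hypothesis beta_gt0 : (0 < beta)%N.
Hypothesis cardF : #|F| = (q ^ (2 * beta))%N.
Hypothesis frobD : forall x y : F, (x + y) ^+ q = x ^+ q + y ^+ q.

Let q_gt0 : (0 < q)%N := ltnW q_gt1.

Variable psi : F -> algC.
Hypothesis psiD : forall x y, psi (x + y) = psi x * psi y.
Hypothesis psi0 : psi 0 = 1.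
Hypothesis psi_Aint : forall x, psi x \in Aint.
Hypothesis psi_frob : forall x, psi (x ^+ q) = psi x.
Hypothesis psi_nontriv : exists x, psi x != 1.

Local Notation H := (nonzero_powers F q.+1).

(** q^2 - 1 divides q^(2 beta) - 1. The factor q - 1 is kept apart in order to locate the (q-1)-th
    roots of unity. *)
Lemma cardF_pred : exists2 M, (0 < M)%N & (#|F|.-1 = q.+1 * (q.-1 * M))%N.
Proof.
have /dvdnP[M eM] : ((q ^ 2).-1 %| #|F|.-1)%N.
  by rewrite cardF expnM; apply: dvdn_pred_predX.
exists M.
  rewrite lt0n; apply/negP => /eqP M0; move: eM; rewrite M0 mul0n => eF.
  have := ltn_expl (2 * beta) q_gt1; rewrite -cardF; lia.
rewrite eM mulnC mulnA; congr (_ * _)%N; rewrite expnS expn1; nia.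
Qed.

Lemma powers_dvd : (q.+1 %| #|F|.-1)%N.
Proof. by have [M _ ->] := cardF_pred; apply: dvdn_mulr. Qed.

Lemma card_powers : (#|H| * q.+1 = #|F|.-1)%N.
Proof. by rewrite (card_nonzero_powers alpha_prim powers_dvd) divnK ?powers_dvd. Qed.

(** The order of [H] is a multiple of q - 1, and a cyclic group has only one subgroup of each
    order. *)
Lemma powers_of_exp_pred_eq1 (x : F) : x != 0 -> x ^+ q.-1 = 1 -> x \in H.
Proof.
move=> x0 x1; have [M M0 cF] := cardF_pred; apply/nonzero_powersP.
apply: (exp_eq1_pow alpha_prim cF) => //; first by rewrite muln_gt0 M0; lia.
by rewrite exprM x1 expr1n.
Qed.

(** Additivity gives (-1)^q = -1 for odd and even q alike, so -1 is a (q-1)-th root of unity. *)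
Lemma powersN1 : -1 \in H.
Proof.
apply: powers_of_exp_pred_eq1; first by rewrite oppr_eq0 oner_eq0.
have := additive_powN q_gt0 frobD 1; rewrite expr1n -[in (-1) ^+ q](prednK q_gt0).
by rewrite exprSr mulrN1 => /oppr_inj.
Qed.

Lemma powers_neq0 (h : F) : h \in H -> h != 0.
Proof. by case/nonzero_powersP => z z0 ->; apply: expf_neq0. Qed.

Lemma powersV (h : F) : h \in H -> h^-1 \in H.
Proof.
case/nonzero_powersP => z z0 ->; apply/nonzero_powersP; exists z^-1.
  by rewrite invr_eq0.
by rewrite exprVn.
Qed.

Lemma powersM (g h : F) : g \in H -> h \in H -> g * h \in H.
Proof.
case/nonzero_powersP => y y0 -> /nonzero_powersP[z z0 ->].
by apply/nonzero_powersP; exists (y * z); rewrite ?mulf_neq0 ?exprMn.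
Qed.

(** Translating [x] by [y / a], where [psi y != 1], multiplies the sum by [psi y]. *)
Lemma sum_psi (a : F) : a != 0 -> \sum_x psi (a * x) = 0.
Proof.
move=> a0; have [y y1] := psi_nontriv.
have eS : \sum_x psi (a * x) = psi y * \sum_x psi (a * x).
  rewrite mulr_sumr (reindex_inj (addIr (y / a))) /=; apply: eq_bigr => x _.
  by rewrite -psiD; congr psi; field.
apply/eqP; move/eqP: eS; rewrite -subr_eq0 -{1}[\sum_x _]mul1r -mulrBl mulf_eq0.
by rewrite subr_eq0 eq_sym (negPf y1).
Qed.

Definition power_sum (a : F) : algC := \sum_z psi (a * z ^+ q.+1).
Local Notation S := power_sum.

Lemma power_sumM (a h : F) : h \in H -> S (a * h) = S a.
Proof.
case/nonzero_powersP => w w0 ->; rewrite /S [RHS](reindex_inj (mulfI w0)) /=.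
by apply: eq_bigr => z _; rewrite exprMn mulrA.
Qed.

Lemma power_sumN (a : F) : S (- a) = S a.
Proof. by rewrite -mulrN1 power_sumM ?powersN1. Qed.

(* Substituting x = y + z in S(a) S(-a) leaves, for each z, a character sum that
   is linear in y ^+ q, because psi (a y z^q) = psi (a^q y^q z^(q^2)); only z = 0
   survives. *)
Lemma power_sum_sqr (a : F) :
    a != 0 -> (forall z, z != 0 -> (a * z ^+ q.+1) ^+ q.-1 != -1) ->
  S a ^+ 2 = #|F|%:R.
Proof.
move=> a0 anis; rewrite expr2 -{2}power_sumN /S mulr_sumr.
under eq_bigr => y _ do rewrite mulr_suml (reindex_inj (addIr y)) /=.
rewrite exchange_big /= (bigD1 0) //= [X in _ + X]big1 ?addr0 => [|z z0].
  under eq_bigr => y _ do rewrite add0r -psiD mulNr subrr psi0.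
  by rewrite sumr_const.
(* This is the coefficient of [y ^+ q]. Were it zero, division by [a * z] would give exactly the
   equation that [anis] excludes. *)
have c0 : a * z + a ^+ q * (z ^+ q) ^+ q != 0.
  apply: contra (anis z z0); rewrite addrC addr_eq0 => /eqP eaz.
  rewrite -(inj_eq (mulIf (mulf_neq0 a0 z0))) mulN1r -eaz.
  have -> : a ^+ q = a ^+ q.-1 * a by rewrite -exprSr prednK.
  have -> : (z ^+ q) ^+ q = (z ^+ q.+1) ^+ q.-1 * z.
    by rewrite -!exprM -exprSr; congr (_ ^+ _); nia.
  by apply/eqP; rewrite exprMn; ring.
rewrite -[RHS](mulr0 (psi (a * z ^+ q.+1))) -[X in _ = _ * X](sum_psi c0).
rewrite [in RHS](reindex_inj (additive_pow_inj q_gt0 frobD)) mulr_sumr.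
apply: eq_bigr => y _; rewrite -!psiD.
have {1}-> : a * (z + y) ^+ q.+1 + - a * y ^+ q.+1 =
  a * z ^+ q.+1 + a * z * y ^+ q + a * y * z ^+ q.
  by rewrite !exprSr frobD; ring.
rewrite mulrDl addrA !psiD; congr (_ * _); rewrite -[LHS]psi_frob !exprMn.
by congr psi; ring.
Qed.

Definition signed_pow : int := (- q%:Z) ^+ beta.

Lemma signed_pow_sqr_int : signed_pow ^+ 2 = #|F|%:Z.
Proof. by rewrite cardF /signed_pow -exprM mulnC exprM sqrrN -exprM -[q%:Z]natz -natrX natz. Qed.

Lemma signed_pow_sqr : (signed_pow%:~R : algC) ^+ 2 = #|F|%:R.
Proof. by rewrite -rmorphXn /= signed_pow_sqr_int. Qed.

Lemma signed_pow_neqN1 : (signed_pow%:~R + 1 : algC) != 0.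
Proof.
rewrite addr_eq0; apply/negP => /eqP e1; have := signed_pow_sqr; rewrite e1 sqrrN expr1n.
move/eqP; rewrite eq_sym (eqr_nat _ _ 1) cardF => /eqP.
by have := ltn_expl (2 * beta) q_gt1; lia.
Qed.

(** -q is 1 modulo q + 1; the witness comes from the geometric sum for (-q)^beta - 1. *)
Lemma signed_pow_cong : exists t : int, signed_pow = 1 + t * q.+1%:Z.
Proof.
have := subrX1 (- q%:Z) beta; set s := \sum_(i < beta) _ => es.
by exists (- s); rewrite /signed_pow -[LHS](subrK 1) es -addn1 PoszD; ring.
Qed.

(** With 0 excluded, these are the unions of cosets of [H] in the multiplicative group. *)
Definition powers_stable (D : {set F}) : Prop :=
  0 \notin D /\ forall h x, h \in H -> x \in D -> h * x \in D.

Lemma stable_mem (D : {set F}) (h x : F) :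
  powers_stable D -> h \in H -> (h * x \in D) = (x \in D).
Proof.
move=> [_ Dh] hH; apply/idP/idP => [hx|]; last exact: Dh.
by rewrite -[x](mulKf (powers_neq0 hH)) Dh ?powersV.
Qed.

Lemma powers_stable_powers : powers_stable H.
Proof.
by split=> [|h x]; [apply/negP => /powers_neq0/eqP | apply: powersM].
Qed.

(* D is stable under x |-> z ^+ q.+1 * x, so summing over all z <> 0 only
   multiplies the transform of D by #|F| - 1. *)
Lemma power_sum_average (D : {set F}) (a : F) : powers_stable D ->
  #|F|.-1%:R * \sum_(x in D) psi (a * x) = \sum_(x in D) (S (a * x) - 1).
Proof.
move=> sD; rewrite mulr_natl -card_nonzero -sumr_const.
under [RHS]eq_bigr => x _ do rewrite /S (bigD1 0) //= expr0n mulr0 psi0 addrAC subrr add0r.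
rewrite [RHS]exchange_big /=; apply: eq_bigr => z z0.
have zn0 : z ^+ q.+1 != 0 by rewrite expf_neq0.
rewrite (reindex_inj (mulfI zn0)) /=; apply: eq_big => x.
  by rewrite stable_mem //; apply/nonzero_powersP; exists z.
by move=> _; congr psi; ring.
Qed.

(** The term z = 0 gives 1, and each element of [H] is z^(q+1) for q + 1 values of z. The proof
    reads this off the averaging identity for [H] itself, on which the power sum is constant. *)
Lemma power_sum_cong (a : F) : exists2 P, P \in Aint & S a = 1 + q.+1%:R * P.
Proof.
exists (\sum_(x in H) psi (a * x)); first by apply: rpred_sum => x _.
have h0 : (#|H|%:R : algC) != 0.
  rewrite pnatr_eq0 -lt0n; apply/card_gt0P; exists (-1); exact: powersN1.
apply: (mulfI h0); rewrite mulrDr mulr1 mulrA -natrM card_powers.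
rewrite (power_sum_average _ powers_stable_powers).
under eq_bigr => x xH do rewrite power_sumM //.
by rewrite sumr_const -mulr_natl; ring.
Qed.

(* The sign of the square root is decided modulo q + 1 >= 3, where
   power_sum_cong and signed_pow_cong both give 1. *)
Lemma power_sum_anisotropic (a : F) :
    a != 0 -> (forall z, z != 0 -> (a * z ^+ q.+1) ^+ q.-1 != -1) ->
  S a = signed_pow%:~R.
Proof.
move=> a0 anis; have /eqP := power_sum_sqr a0 anis.
rewrite -signed_pow_sqr eqf_sqr => /orP[/eqP //|/eqP Sa]; exfalso.
have [P AP Pa] := power_sum_cong a; have [t et] := signed_pow_cong.
have qn0 : (q.+1%:R : algC) != 0 by rewrite pnatr_eq0.
have eP : P = (- signed_pow - 1)%:~R / q.+1%:~R.
  apply: (mulfI qn0); rewrite mulrCA divff // mulr1.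
  by rewrite rmorphB rmorphN /= -Sa Pa; ring.
(* [P] is rational by [eP] and an algebraic integer, hence an integer [n]. The two congruences then
   give (q + 1)(n + t) = -2, which q + 1 >= 3 forbids. *)
have /intrP[n Pn] : P \in Num.int.
  by apply: Cint_rat_Aint => //; rewrite eP rpred_div // rpred_int.
have /eqP : (q.+1%:R * P : algC) = (- signed_pow - 1)%:~R.
  by rewrite eP mulrCA divff // mulr1.
rewrite Pn -[_%:R]/((q.+1%:Z)%:~R) -intrM eqr_int et => /eqP en.
have : q.+1%:Z * (n + t) = - 2 by rewrite mulrDr en; ring.
move: (n + t) => m em; have [m0|m0] := lerP 0 m; last by nia.
by have := mulr_ge0 (ler0n int q.+1) m0; rewrite natz em.
Qed.

(* The solutions v of v^(q-1) = -1 form at most one coset of the (q-1)-th roots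
   of unity, and these roots lie in H. *)
Lemma exists_generic_coset :
  exists2 s : F, s != 0 &
    forall a, a != 0 -> a / s \notin H -> S a = signed_pow%:~R.
Proof.
have [s s0 sP] : exists2 s : F, s != 0 &
    forall v, v ^+ q.-1 = -1 -> v / s \in H.
  case: (pickP (fun v : F => v ^+ q.-1 == -1)) => [s /eqP s1|no].
    have s0 : s != 0.
      apply/negP => /eqP sE; move/eqP: s1; rewrite sE expr0n.
      case: (q.-1 =P 0%N) => [|_]; first by lia.
      by rewrite eq_sym oppr_eq0 oner_eq0.
    exists s => // v v1; apply: powers_of_exp_pred_eq1; last first.
      by rewrite exprMn exprVn v1 s1 divff // oppr_eq0 oner_eq0.
    rewrite mulf_neq0 ?invr_eq0 //; apply/negP => /eqP vE.
    move/eqP: v1; rewrite -s1 vE expr0n; case: (q.-1 =P 0%N) => [|_]; first by lia.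
    by rewrite eq_sym expf_eq0 (negPf s0) andbF.
  (* Without any such [v] the condition is empty and [s] is arbitrary, so solvability need not be
     proved. *)
  by exists 1; rewrite ?oner_eq0 // => v /eqP; rewrite no.
exists s => // a a0 asH; apply: power_sum_anisotropic => // z z0.
apply: contra asH => /eqP/sP.
rewrite mulrAC mulrC => azH; rewrite -[a / s](mulKf (expf_neq0 q.+1 z0)).
rewrite powersM // powersV //; apply/nonzero_powersP; by exists z.
Qed.

Lemma power_sum0 : S 0 = #|F|%:R.
Proof.
rewrite /S; under eq_bigr do rewrite mul0r psi0.
by rewrite sumr_const.
Qed.

(** Summed over all [b], only z = 0 contributes, which gives [#|F|]; the term b = 0 alone has this
    same value. *)
Lemma sum_power_sum : \sum_(b | b != 0) S b = 0.
Proof.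
have : \sum_b S b = #|F|%:R.
  rewrite /S exchange_big (bigD1 0) //= [X in _ + X]big1 ?addr0 => [|z z0].
    by under eq_bigr do rewrite expr0n mulr0 psi0; rewrite sumr_const.
  under eq_bigr do rewrite mulrC.
  by rewrite sum_psi // expf_neq0.
by rewrite (bigD1 0) //= power_sum0 => /eqP; rewrite -subr_eq0 addrAC subrr add0r => /eqP.
Qed.

(** * The exceptional coset and the transform of a stable set *)

Variable s : F.
Hypothesis s_neq0 : s != 0.
Hypothesis power_sum_generic : forall a : F, a != 0 -> a / s \notin H -> S a = signed_pow%:~R.

(** The sum is constant on the coset of [s] and equals eps = [signed_pow] on the others. Since the
    total over nonzero arguments vanishes, |H| (S b - eps) = -(#|F| - 1) eps, where #|F| - 1 = |H|
    (q + 1). *)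
Lemma power_sum_special (b : F) : b / s \in H -> S b = - q%:R * signed_pow%:~R.
Proof.
move=> bsH; have Sc c : c / s \in H -> S c = S b.
  move=> csH; rewrite -[c](divfK s_neq0) -[b](divfK s_neq0) ![_ / s * s]mulrC.
  by rewrite !power_sumM.
suff : #|H|%:R * (S b - signed_pow%:~R) = #|H|%:R * (- q.+1%:R * signed_pow%:~R).
  have h0 : (#|H|%:R : algC) != 0.
    by rewrite pnatr_eq0 -lt0n; apply/card_gt0P; exists (-1); apply: powersN1.
  move/(mulfI h0)/eqP; rewrite subr_eq => /eqP ->; rewrite -natr1; ring.
transitivity (\sum_(c | c != 0) (S c - signed_pow%:~R)).
  rewrite (bigID (fun c => c / s \in H)) /= [X in _ = _ + X]big1 ?addr0; last first.
    by move=> c /andP[c0 cH]; rewrite power_sum_generic // subrr.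
  rewrite (reindex_inj (mulIf s_neq0)) /=.
  rewrite (eq_bigl (fun c => c \in H)) => [|c]; last first.
    rewrite mulfK // mulf_eq0 (negPf s_neq0) orbF.
    by case: (boolP (c \in H)) => [/powers_neq0->|]; rewrite ?andbF.
  under eq_bigr => c cH do rewrite Sc ?mulfK //.
  by rewrite sumr_const mulr_natl.
rewrite big_split /= sum_power_sum add0r sumr_const card_nonzero -card_powers.
by rewrite -[LHS]mulr_natl natrM; ring.
Qed.

Lemma signed_pow_neq1 : (signed_pow%:~R - 1 : algC) != 0.
Proof.
rewrite subr_eq0; apply/negP => /eqP e1; have := signed_pow_sqr; rewrite e1 expr1n.
move/eqP; rewrite eq_sym (eqr_nat _ _ 1) cardF => /eqP.
by have := ltn_expl (2 * beta) q_gt1; lia.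
Qed.

(** By averaging, the transform is determined by how many [x] in [D] put [a * x] in the exceptional
    coset. The factor #|F| - 1 = (eps - 1)(eps + 1) is then cancelled. *)
Lemma stable_transform (D : {set F}) (a : F) (k : algC) :
    powers_stable D -> #|D|%:R = k * (signed_pow%:~R + 1) -> a != 0 ->
  \sum_(x in D) psi (a * x) = k - signed_pow%:~R * (s / a \in D)%:R.
Proof.
move=> sD cD a0; apply: (mulfI signed_pow_neqN1); apply: (mulfI signed_pow_neq1).
have cF : (#|F|.-1%:R : algC) = (signed_pow%:~R - 1) * (signed_pow%:~R + 1).
  rewrite -subn1 natrB -?signed_pow_sqr; first by ring.
  by apply/card_gt0P; exists 0.
rewrite mulrA -cF power_sum_average //.
(* On the exceptional coset the sum drops from eps to -q eps, that is, by (q + 1) eps. *)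
transitivity (\sum_(x in D) (signed_pow%:~R - 1)
   - \sum_(x in D | a * x / s \in H) q.+1%:R * signed_pow%:~R : algC).
  rewrite [X in _ - X]big_mkcondr -sumrB; apply: eq_bigr => x xD.
  have x0 : x != 0 by apply: contraNneq sD.1 => <-.
  case: ifPn => axH; last by rewrite subr0 power_sum_generic ?mulf_neq0.
  by rewrite power_sum_special // -natr1; ring.
rewrite !sumr_const -[X in X - _]mulr_natl -[X in _ - X]mulr_natl cD.
(* The [x] with [a * x] in the exceptional coset form the coset of [s / a], which [D] contains or
   misses entirely. *)
suff -> : #|[pred x in D | a * x / s \in H]| = ((s / a \in D) * #|H|)%N.
  have hq : #|H|%:R * q.+1%:R = (signed_pow%:~R - 1) * (signed_pow%:~R + 1) :> algC.
    by rewrite -natrM card_powers.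
  by rewrite natrM -[X in _ - X]mulrA [#|H|%:R * (_ * _)]mulrA hq; ring.
have sa0 : s / a != 0 by rewrite mulf_neq0 ?invr_eq0.
case: (boolP (s / a \in D)) => saD; rewrite ?mul1n ?mul0n.
  rewrite -(card_imset H (mulIf sa0)); apply: eq_card => x; rewrite inE /=.
  apply/andP/imsetP => [[xD xH]|[h hH ->]].
    by exists (a * x / s) => //; field; rewrite a0.
  split; first by change (h * (s / a) \in D); rewrite stable_mem.
  suff -> : a * (h * (s / a)) / s = h by [].
  by field; rewrite a0 s_neq0.
apply: eq_card0 => x; rewrite inE /=; apply: contraNF saD => /andP[xD xH].
rewrite -(stable_mem _ sD xH); suff -> : a * x / s * (s / a) = x by [].
by field; rewrite a0.
Qed.

(** * Fourier inversion and the number of representations of a difference *)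

Lemma stable_oppE (D : {set F}) (x : F) : powers_stable D -> (- x \in D) = (x \in D).
Proof. by move=> sD; rewrite -mulN1r stable_mem ?powersN1. Qed.

(** The involution x -> s / x carries [D] to a stable set [D'] of the same size, and the sum is the
    transform of [D'] at [- c]. *)
Lemma sum_dual (D : {set F}) (c : F) (k : algC) :
    powers_stable D -> #|D|%:R = k * (signed_pow%:~R + 1) -> c != 0 ->
  \sum_(a | a != 0) (s / a \in D)%:R * psi (a * - c)
    = k - signed_pow%:~R * (c \in D)%:R.
Proof.
move=> sD cD c0; pose D' := [set s / x | x in D].
have invs_inj : injective (fun x : F => s / x).
  by move=> x y /(mulfI s_neq0)/invr_inj.
have D'E x : (s / x \in D') = (x \in D) by apply: (mem_imset _ _ invs_inj).
have invsK x : s / (s / x) = x by rewrite invf_div mulrCA divff ?mulr1.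
have sD' : powers_stable D'.
  split=> [|h x hH].
    rewrite -[0](invsK 0) D'E invr0 mulr0; exact: sD.1.
  rewrite -[x]invsK D'E -[h * _]invsK D'E => xD.
  suff -> : s / (h * (s / (s / x))) = h^-1 * (s / x).
    by rewrite stable_mem ?powersV.
  by rewrite invsK invfM; ring.
have cD' : #|D'|%:R = k * (signed_pow%:~R + 1) by rewrite card_imset.
have nc0 : - c != 0 by rewrite oppr_eq0.
have := stable_transform sD' cD' nc0.
rewrite D'E stable_oppE // => <-.
rewrite big_mkcond [RHS]big_mkcond; apply: eq_bigr => a _.
rewrite -[X in X \in D'](invsK a) D'E.
have [-> /=|a0 /=] := eqVneq a 0; first by rewrite invr0 mulr0 (negPf sD.1).
by case: (_ \in D); rewrite ?mul0r // mul1r mulrC.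
Qed.

(** By orthogonality, #|F| = eps^2 times the count is the sum over [a] of the transform of [D] at
    [a], that of [E] at [- a], and [psi (a * - c)]. The intersection enters because the product of
    the two indicators of [s / a] is the indicator of [D :&: E]. *)
Lemma stable_difference_count (D E : {set F}) (c : F) (kD kE kI : int) :
    powers_stable D -> powers_stable E -> c != 0 ->
    #|D|%:Z = kD * (signed_pow + 1) -> #|E|%:Z = kE * (signed_pow + 1) ->
    #|D :&: E|%:Z = kI * (signed_pow + 1) ->
  (\sum_(x in D) \sum_(y in E) ((x - y)%R == c))%N%:Z =
    kD * kE + kD * (c \in E)%:Z + kE * (c \in D)%:Z + kI
      - signed_pow * (c \in D :&: E)%:Z.
Proof.
move=> sD sE c0 cD cE cI.
have toC (A : {set F}) (k : int) :
    #|A|%:Z = k * (signed_pow + 1) -> #|A|%:R = k%:~R * (signed_pow%:~R + 1) :> algC.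
  by move/(congr1 (intr : int -> algC)); rewrite rmorphM rmorphD.
have {}cD := toC _ _ cD; have {}cE := toC _ _ cE; have {}cI := toC _ _ cI.
have sI : powers_stable (D :&: E).
  split=> [|h x hH]; first by rewrite inE negb_and sD.1.
  by rewrite !inE !stable_mem.
apply: (@intr_inj algC); rewrite -[LHS]/(_%:R).
have eF0 : (signed_pow%:~R : algC) ^+ 2 != 0.
  by rewrite signed_pow_sqr pnatr_eq0 -lt0n; apply/card_gt0P; exists 0.
apply: (mulfI eF0); rewrite {1}signed_pow_sqr natr_sum mulr_sumr.
transitivity (\sum_a (\sum_(x in D) psi (a * x)) * (\sum_(y in E) psi (- a * y))
                * psi (a * - c)).
  transitivity (\sum_(x in D) \sum_(y in E) \sum_a psi ((x - y - c) * a)).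
    apply: eq_bigr => x _; rewrite natr_sum mulr_sumr; apply: eq_bigr => y _.
    rewrite -[x - y == c]subr_eq0; have [->|d0] := eqVneq (x - y - c) 0.
      by under eq_bigr do rewrite mul0r psi0; rewrite sumr_const mulr1.
    by rewrite mulr0 sum_psi.
  under eq_bigr do rewrite exchange_big.
  rewrite exchange_big; apply: eq_bigr => a _ /=.
  rewrite mulr_suml mulr_suml; apply: eq_bigr => x _.
  rewrite mulr_sumr mulr_suml; apply: eq_bigr => y _.
  by rewrite -!psiD; congr psi; ring.
rewrite (bigD1 0) //=.
have hat0 (A : {set F}) : \sum_(x in A) psi (0 * x) = #|A|%:R.
  by under eq_bigr do rewrite mul0r psi0; rewrite sumr_const.
rewrite oppr0 !hat0 mul0r psi0 mulr1 cD cE.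
pose d (A : {set F}) a : algC := (s / a \in A)%:R.
(* The term a = 0 is |D| |E|; for the other [a] the product of transforms is expanded, and each
   resulting sum is evaluated by [sum_psi] or [sum_dual]. *)
transitivity (kD%:~R * (signed_pow%:~R + 1) * (kE%:~R * (signed_pow%:~R + 1)) +
   (\sum_(a | a != 0) kD%:~R * kE%:~R * psi (a * - c)
    - \sum_(a | a != 0) signed_pow%:~R * kD%:~R * (d E a * psi (a * - c))
    - \sum_(a | a != 0) signed_pow%:~R * kE%:~R * (d D a * psi (a * - c))
    + \sum_(a | a != 0) signed_pow%:~R ^+ 2 * (d (D :&: E) a * psi (a * - c))) : algC).
  congr (_ + _); rewrite -!sumrB -big_split; apply: eq_bigr => a a0 /=.
  have na0 : - a != 0 by rewrite oppr_eq0.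
  rewrite (stable_transform sD cD a0) (stable_transform sE cE na0).
  rewrite invrN mulrN stable_oppE //.
  have -> : d (D :&: E) a = d D a * d E a by rewrite /d inE -natrM mulnb.
  by rewrite -/(d D a) -/(d E a); ring.
have sum_psi_nz : \sum_(a | a != 0) psi (a * - c) = -1.
  have nc0 : - c != 0 by rewrite oppr_eq0.
  have := sum_psi nc0; rewrite (bigD1 0) //= mulr0 psi0 => /eqP.
  rewrite addrC addr_eq0 => /eqP <-; by apply: eq_bigr => a _; rewrite mulrC.
rewrite -!mulr_sumr sum_psi_nz.
rewrite (sum_dual sD cD c0) (sum_dual sE cE c0) (sum_dual sI cI c0).
have boolZ (b : bool) : (b%:Z%:~R : algC) = b%:R by [].
by rewrite !(rmorphD, rmorphB, rmorphM, rmorphN) /= !boolZ; ring.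
Qed.

End SemiprimitiveSums.

(** * Multiplicities in difference multisets *)

Section DifferenceCounts.

Variable G : finZmodType.
Implicit Types (A B S : {set G}) (M : {mset G}) (c : G).

Lemma big_msetDE (J : Type) (r : seq J) (P : pred J) (M : J -> {mset G}) c :
  (\big[@msetD G/mset0]_(j <- r | P j) M j) c = (\sum_(j <- r | P j) M j c)%N.
Proof.
by apply: (big_morph (fun X : {mset G} => X c)) => [X Y|]; rewrite ?msetE2 ?mset0E.
Qed.

(** Pairs with x = y are counted too, so for A = B this agrees with [Delta] only at nonzero [c]. *)
Definition difference_count A B c : nat :=
  (\sum_(x in A) \sum_(y in B) ((x - y)%R == c))%N.

Lemma Delta2E A B c : Delta2 A B c = difference_count A B c.
Proof.
rewrite big_msetDE; apply: eq_bigr => x _; rewrite big_msetDE.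
by apply: eq_bigr => y _; rewrite msetnE eq_sym; case: eqP.
Qed.

Lemma Delta0 A : Delta A 0 = 0%N.
Proof.
rewrite big_msetDE big1 // => x _; rewrite big_msetDE big1 // => y /andP[_ xy].
by rewrite msetnE eq_sym subr_eq0 (negPf xy).
Qed.

Lemma DeltaE A c : c != 0 -> Delta A c = difference_count A A c.
Proof.
move=> c0; rewrite big_msetDE; apply: eq_bigr => x _; rewrite big_msetDE.
rewrite big_mkcondr; apply: eq_bigr => y _; rewrite msetnE [c == _]eq_sym.
have [->|_ /=] := eqVneq x y; last by case: eqP.
by rewrite subrr eq_sym (negPf c0).
Qed.

Lemma copiesE n A c : copies n A c = ((c \in A) * n)%N.
Proof.
rewrite big_msetDE; under eq_bigr do rewrite msetnE.
have [cA|cA] := boolP (c \in A).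
  rewrite (bigD1 c) //= eqxx big1 ?addn0 ?mul1n // => y /andP[_ yc].
  by rewrite eq_sym (negPf yc).
by rewrite big1 // => y yA; case: eqP cA => // ->; rewrite yA.
Qed.

Lemma mset_constP M n : M 0 = 0%N ->
  (M = copies n (nonzero G)) <-> (forall c, c != 0 -> M c = n).
Proof.
move=> M0; split=> [-> c c0|Mc]; first by rewrite copiesE !inE c0 mul1n.
apply/msetP => c; rewrite copiesE !inE.
by have [->|c0] := eqVneq c 0; rewrite ?M0 // mul1n Mc.
Qed.

(** As [S] is nonempty, [lam] is a multiplicity and hence a natural number; [S] may exhaust the
    nonzero elements, so for [mu] the sign has to be assumed. *)
Lemma two_level_intro M S (lam mu : int) :
    M 0 = 0%N -> S \subset nonzero G -> S != set0 -> 0 <= mu ->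
    (forall c, c != 0 -> (M c)%:Z = if c \in S then lam else mu) ->
  two_level M S lam mu.
Proof.
move=> M0 /subsetP S0 /set0Pn[s sS] mu0 Mc.
have nz x : x \in S -> x != 0 by move/S0; rewrite !inE.
exists (M s), `|mu|%N; split; first by rewrite Mc ?sS ?nz.
  by rewrite gez0_abs.
apply/msetP => c; rewrite msetE2 !copiesE !inE.
have [cS|cS] := boolP (c \in S).
  rewrite mul1n mul0n addn0; apply/eqP; rewrite -eqz_nat.
  by rewrite !Mc ?nz // cS sS.
have [->|c0] := eqVneq c 0; first by rewrite M0.
apply/eqP; rewrite mul0n add0n mul1n -eqz_nat Mc // (negPf cS) gez0_abs //.
Qed.

End DifferenceCounts.

(** * Disjoint unions *)

Lemma sum_mem_bigcup (T J : finType) (P : pred J) (A : J -> {set T}) (x : T) :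
    (forall i j, P i -> P j -> i != j -> [disjoint A i & A j]) ->
  (\sum_(j | P j) (x \in A j) = (x \in \bigcup_(j | P j) A j))%N.
Proof.
move=> disjA; have [/bigcupP[i Pi xi]|xA] := boolP (x \in _).
  rewrite (bigD1 i) //= xi big1 ?addn0 // => j /andP[Pj ji].
  by rewrite (disjointFl (disjA _ _ Pj Pi ji) xi).
rewrite big1 // => j Pj; apply/eqP; rewrite eqb0.
by apply: contraNN xA => xj; apply/bigcupP; exists j.
Qed.

Lemma card_disjoint_bigcup (T J : finType) (P : pred J) (A : J -> {set T}) :
    (forall i j, P i -> P j -> i != j -> [disjoint A i & A j]) ->
  (#|\bigcup_(j | P j) A j| = \sum_(j | P j) #|A j|)%N.
Proof.
move=> disjA; rewrite -sum1_card big_mkcond.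
under eq_bigr => x _ do rewrite -[if _ then _ else _]/(nat_of_bool _)
  -(sum_mem_bigcup x disjA).
rewrite exchange_big; apply: eq_bigr => j _ /=.
by rewrite -sum1_card [RHS]big_mkcond.
Qed.

(** * Internal and external differences of a family with known pair counts *)

Section Families.

Variables (G : finZmodType) (w k : nat) (D : 'I_w -> {set G}) (K eps : int).

Hypothesis w_gt0 : (0 < w)%N.
Hypothesis k_gt0 : (0 < k)%N.
Hypothesis D_k : disjoint_ksubsets k D.
Hypothesis inner_count : forall a c, c != 0 ->
  (difference_count (D a) (D a) c)%:Z
    = K ^+ 2 + K + (2 * K - eps) * (c \in D a)%:Z.
Hypothesis cross_count : forall a b c, a != b -> c != 0 ->
  (difference_count (D a) (D b) c)%:Z
    = K ^+ 2 + K * ((c \in D a)%:Z + (c \in D b)%:Z).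

Local Notation S := (family_union D).

Lemma D_neq0 a : exists2 x, x \in D a & x != 0.
Proof.
case: D_k => Dnz Dk _; have : (0 < #|D a|)%N by rewrite Dk.
case/card_gt0P => x xD; exists x => //.
by have := subsetP (Dnz a) _ xD; rewrite !inE.
Qed.

Lemma union_sub : S \subset nonzero G.
Proof. by case: D_k => Dnz _ _; apply/bigcupsP. Qed.

Lemma union_neq0 : exists2 x, x \in S & x != 0.
Proof.
have [x xD x0] := D_neq0 (Ordinal w_gt0).
by exists x => //; apply/bigcupP; exists (Ordinal w_gt0).
Qed.

Lemma sum_mem_union c : \sum_a (c \in D a)%:Z = (c \in S)%:Z.
Proof.
case: D_k => _ _ disjD; rewrite /family_union -sum_mem_bigcup.
  by rewrite -[RHS]natz natr_sum; apply: eq_bigr => a _; rewrite natz.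
by move=> i j _ _; apply: disjD.
Qed.

Lemma internal_count c : c != 0 ->
  (internal_differences D c)%:Z
    = w%:Z * (K ^+ 2 + K) + (2 * K - eps) * (c \in S)%:Z.
Proof.
move=> c0; rewrite big_msetDE -natz natr_sum.
under eq_bigr => a _ do rewrite DeltaE // natz inner_count //.
by rewrite big_split /= -mulr_sumr sum_mem_union sumr_const card_ord -[(_ + _) *+ w]mulr_natl natz.
Qed.

(** Each index meets w - 1 others as first and w - 1 as second member of a pair, hence the factor 2
    (w - 1). *)
Lemma external_count c : c != 0 ->
  (external_differences D c)%:Z
    = w%:Z * (w%:Z - 1) * K ^+ 2 + 2 * (w%:Z - 1) * K * (c \in S)%:Z.
Proof.
move=> c0; rewrite big_msetDE -natz natr_sum.
have cn (a : 'I_w) (x : int) : \sum_(b | a != b) x = (w%:Z - 1) * x.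
  rewrite -[RHS]/((w%:Z - 1) * x) mulrBl mul1r.
  have := sumr_const 'I_w x; rewrite (bigD1 a) //= card_ord.
  rewrite -[x *+ w]mulr_natl natz => <-; rewrite addrAC subrr add0r.
  by apply: eq_bigl => b; rewrite eq_sym.
transitivity (\sum_a \sum_(b | a != b) (K ^+ 2 + K * (c \in D a)%:Z)
   + \sum_a \sum_(b | a != b) K * (c \in D b)%:Z).
  rewrite -big_split; apply: eq_bigr => a _ /=; rewrite big_msetDE natr_sum.
  rewrite -big_split; apply: eq_bigr => b ab /=.
  by rewrite Delta2E natz cross_count //; ring.
rewrite [X in _ + X](exchange_big_dep xpredT) //=.
under [X in _ + X]eq_bigr => b _ do
  (under eq_bigl => a do rewrite eq_sym); rewrite /=.
under eq_bigr do rewrite cn; under [X in _ + X]eq_bigr do rewrite cn.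
rewrite -!mulr_sumr big_split /= -!mulr_sumr !sum_mem_union sumr_const card_ord.
by rewrite -[K *+ w]mulr_natl natz; ring.
Qed.

Lemma internal_differences0 : internal_differences D 0 = 0%N.
Proof. by rewrite big_msetDE big1 // => a _; rewrite Delta0. Qed.

Lemma external_differences0 : external_differences D 0 = 0%N.
Proof.
case: D_k => _ _ disjD.
rewrite big_msetDE big1 // => a _; rewrite big_msetDE big1 // => b ab.
rewrite Delta2E /difference_count big1 // => x xa; rewrite big1 // => y yb.
apply/eqP; rewrite eqb0 subr_eq0; apply: contraTneq xa => ->.
by rewrite (disjointFl (disjD _ _ ab) yb).
Qed.

Lemma internal_two_level (lam mu : int) :
    lam = w%:Z * (K ^+ 2 + K) + (2 * K - eps) -> mu = w%:Z * (K ^+ 2 + K) ->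
  two_level (internal_differences D) S lam mu.
Proof.
move=> -> ->; have [s sS _] := union_neq0.
apply: two_level_intro; rewrite ?internal_differences0 ?union_sub //.
- by apply/set0Pn; exists s.
(* [K] may be negative, but K (K + 1) >= 0 for every integer. *)
- by apply: mulr_ge0 => //; nia.
by move=> c c0; rewrite internal_count //; case: (c \in S); rewrite ?mulr1 ?mulr0 ?addr0.
Qed.

Lemma external_two_level (lam mu : int) :
    lam = w%:Z * (w%:Z - 1) * K ^+ 2 + 2 * (w%:Z - 1) * K ->
    mu = w%:Z * (w%:Z - 1) * K ^+ 2 ->
  two_level (external_differences D) S lam mu.
Proof.
move=> -> ->; have [s sS _] := union_neq0.
apply: two_level_intro; rewrite ?external_differences0 ?union_sub //.
- by apply/set0Pn; exists s.
- by rewrite mulr_ge0 ?sqr_ge0 // mulr_ge0 //; lia.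
by move=> c c0; rewrite external_count //; case: (c \in S); rewrite ?mulr1 ?mulr0 ?addr0.
Qed.

(** The members are nonempty and pairwise disjoint, so being no partition can only mean not
    covering. *)
Lemma union_proper :
  ~~ partition [set D a | a : 'I_w] (nonzero G) ->
  exists2 c, c \notin S & c != 0.
Proof.
case: D_k => Dnz Dk disjD np.
have [] := boolP (nonzero G \subset S) => [SG|/subsetPn[c]]; last first.
  by rewrite !inE => c0 cS; exists c.
case/negP: np; apply/and3P; split.
- rewrite cover_imset eqEsubset SG andbT; exact: union_sub.
- apply/trivIsetP => _ _ /imsetP[a _ ->] /imsetP[b _ ->] Dab.
  by apply: disjD; apply: contraNneq Dab => ->.
by apply/imsetP => -[a _ e0]; have [x] := D_neq0 a; rewrite -e0 inE.
Qed.

(** Both sides amount to 2 K = eps: this is the gap between the multiplicities inside and outside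
    the union, and likewise inside and outside one member. *)
Lemma DDF_iff_difference_sets :
  ~~ partition [set D a | a : 'I_w] (nonzero G) ->
  (is_DDF w D <-> forall a, difference_set (D a)).
Proof.
move=> /union_proper[c cS c0]; have [s sS s0] := union_neq0.
suff [toK fromK] : (is_DDF w D <-> 2 * K = eps) /\
    ((forall a, difference_set (D a)) <-> 2 * K = eps).
  by rewrite toK fromK.
split; split.
- case=> _ [l /mset_constP-/(_ internal_differences0) const_l].
  have := internal_count s0; rewrite const_l // sS.
  have := internal_count c0; rewrite const_l // (negPf cS); lia.
- move=> Ke; split; first by exists k.
  exists (w * `|(K ^+ 2 + K)%R|)%N; apply/mset_constP => [|x x0].
    exact: internal_differences0.
  apply/eqP; rewrite -eqz_nat internal_count // Ke subrr mul0r addr0.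
  by rewrite PoszM gez0_abs //; nia.
(* One member is enough: [c] lies outside the union, hence outside [D a]. *)
- move/(_ (Ordinal w_gt0)); set a := Ordinal _.
  case=> l /mset_constP-/(_ (Delta0 _)) const_l.
  have [x xD x0] := D_neq0 a.
  have cD : c \notin D a by apply: contraNN cS => ca; apply/bigcupP; exists a.
  have := inner_count a x0; rewrite -DeltaE // const_l // xD.
  have := inner_count a c0; rewrite -DeltaE // const_l // (negPf cD); lia.
move=> Ke a; exists `|(K ^+ 2 + K)%R|%N; apply/mset_constP => [|x x0].
  exact: Delta0.
apply/eqP; rewrite -eqz_nat DeltaE // inner_count // Ke subrr mul0r addr0.
by rewrite gez0_abs //; nia.
Qed.

(** Equal multiplicities inside and outside the union would force 2 (w - 1) K = 0. *)
Lemma not_EDF : K != 0 -> (2 <= w)%N ->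
  ~~ partition [set D a | a : 'I_w] (nonzero G) -> ~ is_EDF w D.
Proof.
move=> K_neq0 w2 /union_proper[c cS c0]; have [s sS s0] := union_neq0.
case=> _ [l /mset_constP-/(_ external_differences0) const_l].
have := external_count s0; rewrite const_l // sS.
have := external_count c0; rewrite const_l // (negPf cS) => -> eK.
have /eqP : 2 * (w%:Z - 1) * K = 0 by lia.
by rewrite !mulf_eq0 (negPf K_neq0) orbF /=; lia.
Qed.

End Families.

(** * Cyclotomic classes and their unions *)

Section CyclotomicClasses.

Variables (F : finFieldType) (alpha : {unit F}) (e : nat).
Hypothesis alpha_prim : primitive_element alpha.
Hypothesis e_dvdF : (e %| #|F|.-1)%N.

Local Notation C := (cyclotomic_class alpha e).

Lemma cyclotomic_classP i x :
  reflect (exists k, x = val (alpha ^+ (i + e * k))%g) (x \in C i).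
Proof.
apply: (iffP imsetP) => [[y /lcosetP[_ /cycleP[k ->] ->] ->]|[k ->]].
  by exists k; rewrite expgD expgM.
exists (alpha ^+ (i + e * k))%g => //; apply/lcosetP.
by exists (alpha ^+ e ^+ k)%g; rewrite ?mem_cycle // expgD expgM.
Qed.

Lemma cyclotomic_class_mod i j x : x \in C i -> x \in C j -> i = j %[mod e].
Proof.
move=> /cyclotomic_classP[k ->] /cyclotomic_classP[l /val_inj/eqP].
rewrite eq_expg_mod_order (order_primitive alpha_prim) => /eqP ekl.
have := congr1 (modn^~ e) ekl; rewrite !modn_dvdm //.
by rewrite ![(_ + e * _)%N]addnC ![(e * _)%N]mulnC !modnMDl.
Qed.

Lemma card_cyclotomic_class i : #|C i| = (#|F|.-1 %/ e)%N.
Proof.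
rewrite card_imset; last exact: val_inj.
by rewrite card_lcoset -orderE orderXdiv (order_primitive alpha_prim).
Qed.

Lemma disjoint_cyclotomic_class (i j : 'I_e) : i != j -> [disjoint C i & C j].
Proof.
move=> ij; apply/pred0P => x /=; apply: contraNF ij => /andP[xi xj].
by apply/eqP/val_inj; have := cyclotomic_class_mod xi xj; rewrite !modn_small.
Qed.

Lemma card_cyclotomic_union (J : {set 'I_e}) :
  #|\bigcup_(i in J) C i| = (#|J| * (#|F|.-1 %/ e))%N.
Proof.
rewrite card_disjoint_bigcup => [|i j _ _]; last exact: disjoint_cyclotomic_class.
by under eq_bigr do rewrite card_cyclotomic_class; rewrite sum_nat_const.
Qed.

Lemma disjoint_cyclotomic_union (J J' : {set 'I_e}) : [disjoint J & J'] ->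
  [disjoint \bigcup_(i in J) C i & \bigcup_(i in J') C i].
Proof.
move=> dJ; apply/pred0P => x /=; apply/negP => /andP[].
case/bigcupP => i iJ xi /bigcupP[j jJ xj].
have [eij|/disjoint_cyclotomic_class/disjointFr/(_ xi)] := eqVneq i j.
  by move: jJ; rewrite -eij (disjointFr dJ iJ).
by rewrite xj.
Qed.

(** Multiplying by an element of [H] shifts the exponent of [alpha] by a multiple of q + 1, hence of
    [e]. *)
Lemma cyclotomic_union_stable (q : nat) (J : {set 'I_e}) :
  (e %| q.+1)%N -> powers_stable q (\bigcup_(i in J) C i).
Proof.
move=> /dvdnP[m em]; split=> [|h x].
  apply/bigcupP => -[i _ /cyclotomic_classP[k /esym/eqP]].
  by apply/negP; rewrite -unitfE (valP (alpha ^+ _)%g).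
rewrite (nonzero_powers_cycle alpha_prim) => /imsetP[_ /cycleP[l ->] ->].
case/bigcupP => i iJ /cyclotomic_classP[k ->]; apply/bigcupP; exists i => //.
apply/cyclotomic_classP; exists (k + m * l)%N.
rewrite -expgM -FinRing.val_unitM -expgD em; congr (val (alpha ^+ _)%g).
by lia.
Qed.

End CyclotomicClasses.

(** * Application to unions of cyclotomic classes *)

Lemma prime_power_gt1 (q : nat) : prime_power q -> (1 < q)%N.
Proof.
by case=> p [n [p_pr n_gt0 ->]]; rewrite -(exp1n n) ltn_exp2r ?prime_gt1.
Qed.

Lemma prime_power_additive (F : finFieldType) (q n : nat) :
  prime_power q -> #|F| = (q ^ n)%N ->
  forall x y : F, (x + y) ^+ q = x ^+ q + y ^+ q.
Proof.
case=> p [m [p_pr m_gt0 ->]]; rewrite -expnM => cF x y.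
have pF := card_finPcharP cF p_pr.
by rewrite exprDn_pchar // pnatX pnatE // pF.
Qed.

(** The count mentions neither the character nor the exceptional coset, so both can be chosen
    here. *)
Lemma powers_stable_difference_count (F : finFieldType) (alpha : {unit F})
    (q beta : nat) (D E : {set F}) (c : F) (kD kE kI : int) :
    prime_power q -> (0 < beta)%N -> #|F| = (q ^ (2 * beta))%N ->
    primitive_element alpha ->
    powers_stable q D -> powers_stable q E -> c != 0 ->
    #|D|%:Z = kD * (signed_pow q beta + 1) -> #|E|%:Z = kE * (signed_pow q beta + 1) ->
    #|D :&: E|%:Z = kI * (signed_pow q beta + 1) ->
  (difference_count D E c)%:Z =
    kD * kE + kD * (c \in E)%:Z + kE * (c \in D)%:Z + kI
      - signed_pow q beta * (c \in D :&: E)%:Z.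
Proof.
move=> q_pp beta_gt0 cF alpha_prim.
have q_gt1 := prime_power_gt1 q_pp.
have frobD := prime_power_additive q_pp cF.
have [psi [psiD psi0 psi_Aint psi_frob psi_nontriv]] :=
  exists_frobenius_invariant_character (ltnW q_gt1) frobD.
have [s s0 Ss] : exists2 s : F, s != 0 & forall a : F, a != 0 ->
    a / s \notin nonzero_powers F q.+1 -> power_sum q psi a = (signed_pow q beta)%:~R.
  by apply: (exists_generic_coset alpha_prim).
by apply: (stable_difference_count alpha_prim _ _ _ frobD psiD psi0 _ s0).
Qed.

Theorem theorem4p9 (F : finFieldType) (alpha : {unit F}) (q q' beta e u w : nat)
    (I : 'I_w -> {set 'I_e})
    (q_pp : prime_power q) (beta_gt0 : (0 < beta)%N)
    (q'E : q' = (q ^ (2 * beta))%N) (cardF : #|F| = q')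
    (alpha_prim : primitive_element alpha)
    (e_ge3 : (3 <= e)%N) (e_dvd : (e %| q + 1)%N)
    (u_gt0 : (0 < u)%N) (w_gt0 : (0 < w)%N) (wu_le_e : (w * u <= e)%N)
    (I_card : forall a, #|I a| = u)
    (I_disj : forall a b, a != b -> [disjoint I a & I b]) :
  let eta : int := uniform_eta q beta e in
  let U : int := u%:Z in
  let W : int := w%:Z in
  let k : nat := (u * ((q' - 1) %/ e))%N in
  let D : 'I_w -> {set F} :=
    fun a => \bigcup_(i in I a) cyclotomic_class alpha e i in
  let partitions : bool := partition [set D a | a : 'I_w] [set~ 0] in
  [/\ is_DPDF q' w k
        (U ^+ 2 * eta ^+ 2 + (3 * U - e%:Z) * eta - 1
           + (W - 1) * (U ^+ 2 * eta ^+ 2 + U * eta))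
        (W * (U ^+ 2 * eta ^+ 2 + U * eta)) D,
      (2 <= w)%N ->
        is_EPDF q' w k
          (W * (W - 1) * U ^+ 2 * eta ^+ 2 + 2 * (W - 1) * U * eta)
          (W * (W - 1) * U ^+ 2 * eta ^+ 2) D,
      ~~ partitions -> (is_DDF w D <-> forall a, difference_set (D a))
    & (2 <= w)%N -> ~~ partitions -> ~ is_EDF w D].
Proof.
move=> eta U W k D partitions.
have cF : #|F| = (q ^ (2 * beta))%N by rewrite cardF.
have q_gt1 := prime_power_gt1 q_pp.
have e_dvdq : (e %| q.+1)%N by rewrite -addn1.
have e_dvdF : (e %| #|F|.-1)%N := dvdn_trans e_dvdq (powers_dvd q_gt1 beta_gt0 cF).
have F_gt1 : (1 < #|F|)%N := finNzRing_gt1 F.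
have kE : k = (u * (#|F|.-1 %/ e))%N by rewrite /k cardF subn1.
(* The division is exact because eps is 1 modulo q + 1, hence modulo [e]. *)
have etaE : eta * e%:Z = signed_pow q beta - 1.
  rewrite /eta /uniform_eta divzK // -/(signed_pow q beta).
  by have [t ->] := signed_pow_cong q beta; rewrite addrAC subrr add0r dvdz_mull.
have cardD a : #|D a| = k by rewrite card_cyclotomic_union // I_card.
pose K := U * eta.
(* Multiplied by [e], both sides are u (eps - 1)(eps + 1) = u (#|F| - 1). *)
have cardDK a : #|D a|%:Z = K * (signed_pow q beta + 1).
  have e0 : e%:Z != 0 by lia.
  apply: (mulIf e0); rewrite cardD kE -PoszM -mulnA divnK //.
  have -> : K * (signed_pow q beta + 1) * e%:Z = U * ((eta * e%:Z) * (signed_pow q beta + 1)).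
    by rewrite /K; ring.
  have -> : eta * e%:Z * (signed_pow q beta + 1) = #|F|%:Z - 1.
    by rewrite etaE -(signed_pow_sqr_int cF); ring.
  by rewrite PoszM -subn1 -subzn // ltnW.
have k_gt0 : (0 < k)%N.
  rewrite kE muln_gt0 u_gt0 divn_gt0; last by lia.
  by apply: dvdn_leq => //; lia.
have K_neq0 : K != 0.
  apply: contraTneq k_gt0 => K0; have := cardDK (Ordinal w_gt0).
  by rewrite cardD K0 mul0r => -[->].
have stD a : powers_stable q (D a) by apply: cyclotomic_union_stable.
have disjD a b : a != b -> [disjoint D a & D b].
  by move=> ab; apply: disjoint_cyclotomic_union => //; apply: I_disj.
have D_k : disjoint_ksubsets k D.
  split=> // a; apply/subsetP => x xD; rewrite !inE.
  by apply: contraNneq (stD a).1 => <-.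
have inner_count a c : c != 0 ->
    (difference_count (D a) (D a) c)%:Z
      = K ^+ 2 + K + (2 * K - signed_pow q beta) * (c \in D a)%:Z.
  move=> c0; have cI : #|D a :&: D a|%:Z = K * (signed_pow q beta + 1) by rewrite setIid.
  rewrite (powers_stable_difference_count q_pp beta_gt0 cF alpha_prim
    (stD a) (stD a) c0 (cardDK a) (cardDK a) cI) setIid; ring.
have cross_count a b c : a != b -> c != 0 ->
    (difference_count (D a) (D b) c)%:Z
      = K ^+ 2 + K * ((c \in D a)%:Z + (c \in D b)%:Z).
  move=> ab c0; have I0 : D a :&: D b = set0.
    by apply/eqP; rewrite setI_eq0 disjD.
  have cI : #|D a :&: D b|%:Z = 0 * (signed_pow q beta + 1) by rewrite I0 cards0 mul0r.
  rewrite (powers_stable_difference_count q_pp beta_gt0 cF alpha_prim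
    (stD a) (stD b) c0 (cardDK a) (cardDK b) cI) I0 in_set0 mulr0; ring.
(* This turns 2 K - eps into (2 u - e) eta - 1; one K from w (K^2 + K) supplies the coefficient 3
   u. *)
have epsE : signed_pow q beta = eta * e%:Z + 1 by rewrite etaE subrK.
split=> [|w2|np|w2 np].
- split=> //; apply: (internal_two_level w_gt0 k_gt0 D_k inner_count).
    by rewrite epsE /K /W; ring.
  by rewrite /K /W; ring.
- split=> //; apply: (external_two_level w_gt0 k_gt0 D_k cross_count).
    by rewrite /K /W; ring.
  by rewrite /K /W; ring.
- exact: (DDF_iff_difference_sets w_gt0 k_gt0 D_k inner_count).
- exact: (not_EDF w_gt0 k_gt0 D_k cross_count K_neq0 w2 np).
Qed.
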